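(* Let $a, b, k_1, k_2 \in \mathbb{R}_{>0}$, let $Z$ be a real random variable with density $f_Z(z) = \frac{1}{2ab\Gamma(a)} \exp\left(-\left|\frac{z}{b}\right|^{\frac1a}\right)$, and let $L(z) = k_1 z$ for $z \ge 0$ and $L(z) = -k_2 z$ for $z < 0$. Let $C$ be the value of $c \in \mathbb{R}$ satisfying $\frac{d}{dc}\mathrm{E}[L(Z+c)] = 0$. Then $\mathrm{E}[L(Z+c)]$, as a function of $c\in\mathbb{R}$, has its minimum value at $c = C$, and $$\gamma\left(a, \left|\frac{C}{b}\right|^{\frac1a}\right) = \mathrm{Sgn}(C)\,\frac{k_2-k_1}{k_1+k_2}\,\Gamma(a).$$ Moreover $\mathrm{Sgn}(C) = \mathrm{Sgn}(k_2-k_1)$, $C = 0$ only when $k_1=k_2$, and the minimum value is $$\mathrm{E}[L(Z+C)] = \frac{(k_1+k_2)b}{2\Gamma(a)}\,\Gamma\left(2a, \left|\frac{C}{b}\right|^{\frac1a}\right).$$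
   Context: For $a>0$ and $x \ge 0$: $\Gamma(a) = \int_0^{+\infty} t^{a-1}e^{-t}\,dt$ is the gamma function, $\Gamma(a,x) = \int_x^{+\infty} t^{a-1}e^{-t}\,dt$ is the upper incomplete gamma function, and $\gamma(a,x) = \int_0^x t^{a-1}e^{-t}\,dt$ is the lower incomplete gamma function. For $c \in \mathbb{R}$, $\mathrm{Sgn}(c) = 1$ if $c \ge 0$ and $\mathrm{Sgn}(c) = -1$ if $c<0$. $\mathrm{E}$ denotes expected value. *)

(* Defs.v *)
From mathcomp Require Import all_boot all_order all_algebra.
From mathcomp Require Import all_classical all_reals all_analysis.
Import Order.TTheory GRing.Theory Num.Theory.
Import numFieldNormedType.Exports.

Set Implicit Arguments.
Unset Strict Implicit.
Unset Printing Implicit Defensive.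

Local Open Scope classical_set_scope.
Local Open Scope ring_scope.

(* At t = 0 the library's real power gives 0 `^ (a - 1) = 0 for a != 1 (even
   for a < 1); this affects the integrands below on a null set only. *)
Definition gammaFun {R : realType} (a : R) : R :=
  \int[@lebesgue_measure R]_(t in `[0, +oo[) (t `^ (a - 1) * expR (- t)).

Definition upperGamma {R : realType} (a x : R) : R :=
  \int[@lebesgue_measure R]_(t in `[x, +oo[) (t `^ (a - 1) * expR (- t)).

Definition lowerGamma {R : realType} (a x : R) : R :=
  \int[@lebesgue_measure R]_(t in `[0, x]) (t `^ (a - 1) * expR (- t)).

(* Unlike Num.sg, this sign is 1 at 0. *)
Definition Sgn {R : realType} (c : R) : R := if 0 <= c then 1 else -1.

Definition has_density {d : measure_display} {T : measurableType d}
    {R : realType} (P : probability T R) (Z : {RV P >-> R}) (f : R -> R) :=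
  [/\ measurable_fun setT f,
      (forall z : R, 0 <= f z)
    & (forall A : set R, measurable A ->
        distribution P Z A = \int[@lebesgue_measure R]_(z in A) (f z)%:E)%E].

Definition fZ {R : realType} (a b z : R) : R :=
  (2 * a * b * gammaFun a)^-1 * expR (- (`|z / b| `^ (a^-1))).

Definition loss {R : realType} (k1 k2 z : R) : R :=
  if 0 <= z then k1 * z else - k2 * z.

Definition expLoss {d : measure_display} {T : measurableType d}
    {R : realType} (P : probability T R) (Z : {RV P >-> R}) (k1 k2 c : R)
    : \bar R :=
  'E_P[fun w => loss k1 k2 (Z w + c)].

(* Main.v *)
From HB Require Import structures.
Require Import Defs.
From mathcomp Require Import all_boot all_order all_algebra.
From mathcomp Require Import all_classical all_reals all_analysis.
From mathcomp Require Import measurable_realfun ring lra.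
Import Order.TTheory GRing.Theory Num.Theory.
Import numFieldNormedType.Exports.

Set Implicit Arguments.
Unset Strict Implicit.
Unset Printing Implicit Defensive.

Local Open Scope classical_set_scope.
Local Open Scope ring_scope.

(** Write L for the loss and F(u) = P(Z < u). The loss is convex with slope
- k2 on the negative half-line and k1 on the nonnegative one, so integrating
its subgradient inequality gives
<<
   E[L(Z + c)] + p(c) (c' - c) <= E[L(Z + c')],   p(c) = k1 - (k1 + k2) F(- c)
>>
for any integrable Z ([expLoss_subgradient]). Exchanging c and c' bounds the
increment of the expected loss from both sides; since the density is bounded,
F is Lipschitz, and the two bounds squeeze the difference quotient to p(c)
([is_derive_subgradient], [strict_cdf_lipschitz]). The same inequality shows
that a zero of p is a global minimum. Since the density is positive, F is
strictly increasing, so p has exactly one zero C, characterized by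
F(- C) = k1 / (k1 + k2).

The closed formulas come from the substitution z = b t^a, which turns the tail
integrals of z^j times the density over [u, +oo[ into
b^j Gamma(a (j + 1), (u / b)^(1/a)) / (2 Gamma(a)) ([tail_density]). For j = 0
this computes F, hence p; p(0) = (k1 - k2) / 2 gives the sign of C, and
p(C) = 0 solves for the incomplete gamma function. For j = 1, splitting the
expectation at Z = - C gives
E[L(Z + C)] = C p(C) + (k1 + k2) E[Z ; Z >= |C|] ([expLoss_value],
[tail_integrals]), whose first term vanishes.

The total mass 1 of the density forces Gamma(a) to be finite and positive
([fZ_mass]). The integral Gamma(2a), and with it the integrability of Z, is
controlled by the bound t^a <= (2a)^a exp(t/2) ([tailGamma_double_lty]). *)

(** * Substitution on an open half-line *)

Lemma bigcup_itv_oy (R : realType) (x : R) :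
  \bigcup_n `[x + n.+1%:R^-1, x + n.+1%:R]%classic = `]x, +oo[%classic.
Proof.
apply/seteqP; split => t /=.
  move=> [n _] /=; rewrite !in_itv/= andbT => /andP[h _].
  by apply: lt_le_trans h; rewrite ltrDl invr_gt0.
rewrite in_itv/= andbT -subr_gt0 => tx.
set m := Num.max (t - x) (t - x)^-1.
have hm : m < (Num.truncn m).+1%:R by exact: truncnS_gt.
exists (Num.truncn m) => //=; rewrite in_itv/=; apply/andP; split.
  rewrite -lerBrDl -[leRHS]invrK lef_pV2 ?posrE ?invr_gt0//; apply: ltW.
  by apply: le_lt_trans hm; rewrite le_max lexx orbT.
by rewrite -lerBlDl; apply: ltW; apply: le_lt_trans hm; rewrite le_max lexx.
Qed.

(** The derivative of F may be unbounded both at x and at infinity, as it is for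
F(t) = b t^a according to the value of a. The change of variables is therefore
applied on compact intervals exhausting the half-line, and both sides pass to
the limit by monotone convergence. *)
Lemma ge0_integration_by_substitution_oy (R : realType) (F G : R -> R) (x y : R) :
  {in `]x, +oo[ &, {homo F : s t / s < t}} ->
  (forall t, x < t -> y < F t) ->
  (forall z, y < z -> exists2 t, x < t & F t = z) ->
  (forall t, x < t -> derivable F t 1) ->
  {in `]x, +oo[, continuous F^`()%classic} ->
  {in `]y, +oo[, continuous G} ->
  {in `]y, +oo[, forall z, 0 <= G z} ->
  (\int[@lebesgue_measure R]_(z in `]y, +oo[) (G z)%:E =
   \int[@lebesgue_measure R]_(t in `]x, +oo[) (G (F t) * F^`()%classic t)%:E)%E.
Proof.
move=> incF Fy surjF dF cdF cG G0.
pose l n : R := x + n.+1%:R^-1.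
pose r n : R := x + n.+1%:R.
have lx n : x < l n by rewrite ltrDl invr_gt0.
have lr n : l n <= r n.
  by rewrite lerD2l (@le_trans _ _ 1)// ?invf_le1// ler1n.
have rx n : x < r n by apply: lt_le_trans (lx n) (lr n).
have inx t : (t \in `]x, +oo[) = (x < t) by rewrite in_itv/= andbT.
have iny t : (t \in `]y, +oo[) = (y < t) by rewrite in_itv/= andbT.
have cF t : x < t -> {for t, continuous F}.
  by move=> xt; apply: differentiable_continuous; apply/derivable1_diffP/dF.
have ndF : {in `]x, +oo[ &, {mono F : s t / s <= t}}.
  exact: le_mono_in.
have dF0 t : x < t -> 0 <= F^`()%classic t.
  move=> xt; have dFx : {in `]x, +oo[%classic, forall s, derivable F s 1}.
    by move=> s; rewrite inE/= in_itv/= andbT => /dF.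
  by apply: (incr_derive1_ge0_itvy dFx incF); rewrite inx.
have seg n : (\int[@lebesgue_measure R]_(z in `[F (l n), F (r n)]) (G z)%:E =
   \int[@lebesgue_measure R]_(t in `[l n, r n]) (G (F t) * F^`()%classic t)%:E)%E.
  have gtx t : l n <= t -> x < t by exact: lt_le_trans.
  have gty z : F (l n) <= z -> y < z by apply: lt_le_trans; exact: Fy.
  rewrite (@integration_by_substitution_increasing R F G (l n) (r n) (lr n));
    last 6 first.
  - move=> s t; rewrite !in_itv/= => /andP[/gtx xs _] /andP[/gtx xt _].
    by apply: incF; rewrite inx.
  - move=> t; rewrite in_itv/= => /andP[/ltW/gtx xt _].
    by apply: cdF; rewrite inx.
  - apply/cvg_ex; exists (F^`()%classic (l n)).
    by apply: cvg_at_right_filter; apply: cdF; rewrite inx.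
  - apply/cvg_ex; exists (F^`()%classic (r n)).
    by apply: cvg_at_left_filter; apply: cdF; rewrite inx.
  - split.
    + by move=> t; rewrite in_itv/= => /andP[/ltW/gtx xt _]; exact: dF.
    + by apply: cvg_at_right_filter; exact: cF.
    + by apply: cvg_at_left_filter; exact: cF.
  - apply: continuous_in_subspaceT => z; rewrite inE/= in_itv/= => /andP[h _].
    by apply: cG; rewrite iny gty.
  by [].
have mG : measurable_fun (`]y, +oo[ : set R) (fun z => (G z)%:E).
  apply/measurable_EFinP; apply: open_continuous_measurable_fun => //.
  by move=> z; rewrite inE/= => zy; apply: cG.
have mGF : measurable_fun (`]x, +oo[ : set R)
    (fun t => (G (F t) * F^`()%classic t)%:E).
  apply/measurable_EFinP; apply: open_continuous_measurable_fun => //.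
  move=> t; rewrite inE/= inx => xt; apply: cvgM.
    by apply: continuous_comp; [exact: cF|apply: cG; rewrite iny Fy].
  by apply: cdF; rewrite inx.
have subx n : `[l n, r n]%classic `<=` `]x, +oo[%classic.
  by move=> t /=; rewrite in_itv/= inx => /andP[+ _]; exact: lt_le_trans.
have suby n : `[F (l n), F (r n)]%classic `<=` `]y, +oo[%classic.
  move=> t /=; rewrite in_itv/= iny => /andP[+ _].
  by apply: lt_le_trans; exact: Fy.
have ll m n : (m <= n)%N -> l n <= l m.
  by move=> mn; rewrite lerD2l lef_pV2 ?posrE// ler_nat.
have rr m n : (m <= n)%N -> r m <= r n.
  by move=> mn; rewrite lerD2l ler_nat.
have Uy : \bigcup_n `[F (l n), F (r n)]%classic = `]y, +oo[%classic.
  apply/seteqP; split => [z [n _]|z /=]; first exact: suby.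
  rewrite iny => /surjF[t xt <-].
  have : `]x, +oo[%classic t by rewrite /= inx.
  rewrite -bigcup_itv_oy => -[n _ /=]; rewrite in_itv/= => /andP[lt tr].
  by exists n => //=; rewrite in_itv/= !ndF ?inx//; apply/andP; split.
have cD : (\int[@lebesgue_measure R]_(z in `[F (l n), F (r n)]) (G z)%:E)%E
    @[n --> \oo] --> (\int[@lebesgue_measure R]_(z in `]y, +oo[) (G z)%:E)%E.
  rewrite -Uy; apply: ge0_nondecreasing_set_cvg_integral => //.
  - move=> m n mn; apply/subsetPset => z /=; rewrite !in_itv/=.
    move=> /andP[h1 h2]; apply/andP; split.
      by apply: le_trans h1; rewrite ndF ?inx// ll.
    by apply: (le_trans h2); rewrite ndF ?inx// rr.
  - by move=> n; apply: measurable_funS mG.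
  - by move=> n z /suby h; rewrite lee_fin; exact: G0.
have cE : (\int[@lebesgue_measure R]_(t in `[l n, r n])
      (G (F t) * F^`()%classic t)%:E)%E @[n --> \oo] -->
    (\int[@lebesgue_measure R]_(t in `]x, +oo[) (G (F t) * F^`()%classic t)%:E)%E.
  rewrite -[X in (\int[_]_(_ in X) _)%E](bigcup_itv_oy x).
  apply: ge0_nondecreasing_set_cvg_integral => //.
  - move=> m n mn; apply/subsetPset => z /=; rewrite !in_itv/=.
    move=> /andP[h1 h2]; apply/andP; split.
      by apply: le_trans h1; rewrite ll.
    by apply: (le_trans h2); rewrite rr.
  - by move=> n; apply: measurable_funS mGF.
  - move=> n z /subx /=; rewrite inx => xz.
    by rewrite lee_fin mulr_ge0 ?dF0// G0// iny Fy.
rewrite (funext seg) in cD.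
exact: cvg_unique cD cE.
Qed.

(** * Gamma integrals *)

Lemma scaled_powRK (R : realType) (a b u : R) : 0 < a -> 0 < b -> 0 <= u ->
  b * ((u / b) `^ a^-1) `^ a = u.
Proof.
move=> a0 b0 u0; rewrite -powRrM mulVf ?gt_eqF// powRr1 ?divr_ge0// ?ltW//.
by rewrite mulrC divfK// gt_eqF.
Qed.

(** The upper incomplete gamma function as an extended real: its real-valued
counterpart is 0 when the integral diverges, so finiteness is read off here. *)
Definition tailGamma {R : realType} (a x : R) : \bar R :=
  (\int[@lebesgue_measure R]_(t in `]x, +oo[) (t `^ (a - 1) * expR (- t))%:E)%E.

Lemma measurable_gamma_integrand (R : realType) (a : R) (D : set R) :
  measurable D -> measurable_fun D (fun t : R => (t `^ (a - 1) * expR (- t))%:E).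
Proof.
move=> mD; apply/measurable_funTS/measurable_EFinP/measurable_funM.
  exact: measurable_powR.
by apply: measurableT_comp => //; exact: measurable_expR.
Qed.

Lemma upperGammaE (R : realType) (a x : R) :
  upperGamma a x = fine (tailGamma a x).
Proof.
rewrite /upperGamma /tailGamma /Rintegral integral_itv_obnd_cbnd//.
exact: measurable_gamma_integrand.
Qed.

Lemma tailGamma_ge0 (R : realType) (a x : R) : (0 <= tailGamma a x)%E.
Proof.
by apply: integral_ge0 => t _; rewrite lee_fin mulr_ge0 ?powR_ge0 ?expR_ge0.
Qed.

Lemma gammaFunE (R : realType) (a : R) : gammaFun a = fine (tailGamma a 0).
Proof. exact: upperGammaE. Qed.

Lemma tailGamma_fin_num (R : realType) (a x : R) : 0 <= x ->
  (tailGamma a 0 < +oo)%E -> tailGamma a x \is a fin_num.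
Proof.
move=> x0 fin; rewrite ge0_fin_numE ?tailGamma_ge0//.
apply: le_lt_trans fin; apply: ge0_subset_integral => //.
- exact: measurable_gamma_integrand.
- by move=> t _; rewrite lee_fin mulr_ge0 ?powR_ge0 ?expR_ge0.
- by apply: subset_itvr; rewrite bnd_simp.
Qed.

Lemma lowerGammaE (R : realType) (a x : R) : 0 <= x ->
  (tailGamma a 0 < +oo)%E -> lowerGamma a x = gammaFun a - upperGamma a x.
Proof.
move=> x0 fin.
have int0 : (@lebesgue_measure R).-integrable `[0%R, +oo[
    (EFin \o (fun t => t `^ (a - 1) * expR (- t))).
  apply/integrableP; split; first exact: measurable_gamma_integrand.
  under eq_integral.
    move=> t _; rewrite /= ger0_norm ?mulr_ge0 ?powR_ge0 ?expR_ge0//.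
    over.
  rewrite -integral_itv_obnd_cbnd//.
  exact: measurable_gamma_integrand.
rewrite /lowerGamma /gammaFun /upperGamma.
have := @Rintegral_itvB R _ (BLeft 0) +oo%O x int0.
rewrite !bnd_simp => /(_ x0 isT); rewrite Rintegral_itv_obnd_cbnd.
  by move=> <-; rewrite subKr.
apply: integrableS int0 => //; apply: subset_itv; by rewrite bnd_simp.
Qed.

(** The substitution z = b t^a, under which (z / b)^(1/a) becomes t and
dz becomes a b t^(a-1) dt. *)
Lemma tail_moment (R : realType) (a b s u : R) :
  0 < a -> 0 < b -> 0 <= u ->
  (\int[@lebesgue_measure R]_(z in `]u, +oo[)
     (z `^ s * expR (- ((z / b) `^ a^-1)))%:E =
   (a * b `^ (s + 1))%:E * tailGamma (a * (s + 1)) ((u / b) `^ a^-1))%E.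
Proof.
move=> a0 b0 u0; set x := (u / b) `^ a^-1.
have x0 : 0 <= x by exact: powR_ge0.
have bxu : b * x `^ a = u by exact: scaled_powRK.
pose F (t : R) := b * t `^ a.
have incF : {in Num.nneg &, {homo F : s t / s < t}}.
  move=> v t v0 t0 vt; rewrite /F ltr_pM2l// gt0_ltr_powR//.
have dF (t : R) : 0 < t -> is_derive t 1 F (b * (a * t `^ (a - 1))).
  by move=> t0; exact: (is_deriveZ b (is_derive1_powR a t0)).
have F'E (t : R) : 0 < t -> F^`()%classic t = b * (a * t `^ (a - 1)).
  by move=> /dF dFt; rewrite derive1E derive_val.
have cpow (p t : R) : 0 < t -> {for t, continuous (@powR R ^~ p)}.
  move=> t0; apply: differentiable_continuous; apply/derivable1_diffP.
  by apply: derivable_powR; rewrite in_itv/= andbT.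
have cF' (t : R) : 0 < t ->
    {for t, continuous (fun v : R => b * (a * v `^ (a - 1)))}.
  by move=> t0; apply: (cvgM (cvg_cst b)); apply: (cvgM (cvg_cst a)); exact: cpow.
have cG (z : R) : u < z ->
    {for z, continuous (fun z : R => z `^ s * expR (- ((z / b) `^ a^-1)))}.
  move=> uz; have z0 := le_lt_trans u0 uz.
  apply: (cvgM (cpow s z z0)).
  apply: (@continuous_comp _ _ _ (fun z : R => - (z / b) `^ a^-1) expR).
    apply: continuousN.
    apply: (@continuous_comp _ _ _ (fun z : R => z / b) (@powR R ^~ a^-1)).
      exact: (cvgM cvg_id (cvg_cst b^-1)).
    by apply: cpow; rewrite divr_gt0.
  exact: continuous_expR.
rewrite (@ge0_integration_by_substitution_oy R F _ x); last 7 first.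
- move=> v t; rewrite !in_itv/= !andbT => xv xt.
  by apply: incF; rewrite nnegrE ltW// (le_lt_trans x0).
- move=> t xt; rewrite -bxu; apply: incF => //; rewrite nnegrE// ltW//.
  exact: le_lt_trans xt.
- move=> z uz; exists ((z / b) `^ a^-1); last first.
    by apply: scaled_powRK => //; rewrite ltW// (le_lt_trans u0).
  rewrite gt0_ltr_powR ?invr_gt0// ?nnegrE ?divr_ge0// ?ltW//.
    exact: le_lt_trans uz.
  by rewrite ltr_pM2r ?invr_gt0.
- by move=> t xt; have [] := dF t (le_lt_trans x0 xt).
- move=> t; rewrite in_itv/= andbT => xt.
  have t0 := le_lt_trans x0 xt.
  rewrite /continuous_at F'E//.
  apply: (@cvg_trans _ ((b * (a * v `^ (a - 1))) @[v --> t])).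
    apply: near_eq_cvg; near=> v; rewrite F'E//; near: v.
    exact: lt_nbhsr.
  exact: cF'.
- move=> z; rewrite in_itv/= andbT => uz.
  exact: cG.
- by move=> z _; rewrite mulr_ge0 ?powR_ge0 ?expR_ge0.
rewrite /tailGamma -ge0_integralZl//; last 3 first.
- exact: measurable_gamma_integrand.
- by move=> t _; rewrite lee_fin mulr_ge0 ?powR_ge0 ?expR_ge0.
- by rewrite lee_fin mulr_ge0 ?powR_ge0// ltW.
apply: eq_integral => t; rewrite inE/= in_itv/= andbT => xt.
have t0 := le_lt_trans x0 xt.
have b1 : b `^ (s + 1) = b `^ s * b.
  by rewrite powRD ?powRr1 ?ltW// (gt_eqF b0) implybT.
have t1 : t `^ (a * (s + 1) - 1) = (t `^ a) `^ s * t `^ (a - 1).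
  rewrite -powRrM -powRD ?(gt_eqF t0) ?implybT//; congr (_ `^ _); ring.
rewrite -EFinM F'E// /F [b * _ / b]mulrC mulKf ?gt_eqF//.
rewrite -(powRrM t a) divff ?gt_eqF// powRr1 ?(ltW t0)//.
rewrite powRM ?powR_ge0// ?(ltW b0)// b1 t1; congr EFin; ring.
Unshelve. all: end_near. Qed.

(** This is the a-th power of s <= exp s at s = t / (2a). *)
Lemma powR_le_expR (R : realType) (a t : R) : 0 < a -> 0 <= t ->
  t `^ a <= (2 * a) `^ a * expR (t / 2).
Proof.
move=> a0 t0; have a2 : 0 < 2 * a by rewrite mulr_gt0.
have -> : expR (t / 2) = expR (t / (2 * a)) `^ a.
  by rewrite -expRM; congr expR; field; rewrite gt_eqF.
rewrite -powRM ?expR_ge0// ?(ltW a2)//.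
apply: ge0_ler_powR; rewrite ?nnegrE ?(ltW a0)//.
  by rewrite mulr_ge0 ?expR_ge0// ltW.
have h : t / (2 * a) <= expR (t / (2 * a)).
  by apply: le_trans (expR_ge1Dx _); rewrite lerDr.
apply: le_trans (ler_wpM2l (ltW a2) h).
by rewrite mulrC divfK ?gt_eqF.
Qed.

Lemma measurable_moment_integrand (R : realType) (p s b : R) (D : set R) :
  measurable D ->
  measurable_fun D (fun z : R => (z `^ s * expR (- ((z / b) `^ p)))%:E).
Proof.
move=> mD; apply/measurable_funTS/measurable_EFinP/measurable_funM.
  exact: measurable_powR.
apply: (measurableT_comp (@measurable_expR R)).
apply: (measurableT_comp (@oppr_measurable R setT)).
apply: (measurableT_comp (@measurable_powR R p)).
exact: measurable_funM.
Qed.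

(** Read through the substitution z = t^a, the claim is the integrability of
z exp(- z^(1/a)). The exponential bound on t^a gives
z exp(- z^(1/a)) <= (2a)^a exp(- z^(1/a) / 2), and the right-hand side is again
of the form exp(- (z / b)^(1/a)), now with b = 2^a; its integral is a multiple
of Gamma(a). *)
Lemma tailGamma_double_lty (R : realType) (a : R) : 0 < a ->
  (tailGamma a 0 < +oo -> tailGamma (a * (1 + 1)) 0 < +oo)%E.
Proof.
move=> a0 fin.
have ai0 : a^-1 != 0 by rewrite gt_eqF// invr_gt0.
have b0 : 0 < (2 : R) `^ a by rewrite powR_gt0.
have E1 : (\int[@lebesgue_measure R]_(z in `]0%R, +oo[)
    (z `^ 1 * expR (- ((z / 1) `^ a^-1)))%:E = a%:E * tailGamma (a * (1 + 1)) 0)%E.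
  have x0 : (0 / 1 : R) `^ a^-1 = 0 by rewrite mul0r (powR0 ai0).
  have c1 : a * 1 `^ (1 + 1) = a by rewrite powR1 mulr1.
  by rewrite (@tail_moment R a 1 1 0 a0 ltr01 (lexx 0)) x0 c1.
have E2 : (\int[@lebesgue_measure R]_(z in `]0%R, +oo[)
    (z `^ 0 * expR (- ((z / 2 `^ a) `^ a^-1)))%:E =
    (a * 2 `^ a)%:E * tailGamma a 0)%E.
  have x0 : (0 / 2 `^ a : R) `^ a^-1 = 0 by rewrite mul0r (powR0 ai0).
  have c1 : a * (2 `^ a) `^ 1 = a * 2 `^ a by rewrite (powRr1 (ltW b0)).
  by rewrite (@tail_moment R a (2 `^ a) 0 0 a0 b0 (lexx 0)) x0 add0r mulr1 c1.
suff : ((a%:E * tailGamma (a * (1 + 1)) 0) < +oo)%E.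
  have := tailGamma_ge0 (a * (1 + 1)) 0.
  case: (tailGamma (a * (1 + 1)) 0) => [r|_|] //; first by rewrite !ltry.
  by rewrite gt0_muley ?lte_fin// ltxx.
rewrite -E1.
have M0 : 0 <= (2 * a) `^ a by exact: powR_ge0.
apply: (@le_lt_trans _ _ (((2 * a) `^ a)%:E * ((a * 2 `^ a)%:E * tailGamma a 0))%E).
  rewrite -E2 -ge0_integralZl//; last 2 first.
  - exact: measurable_moment_integrand.
  - by move=> z _; rewrite lee_fin mulr_ge0 ?powR_ge0 ?expR_ge0.
  apply: ge0_le_integral => //.
  - by move=> z _; rewrite lee_fin mulr_ge0 ?powR_ge0 ?expR_ge0.
  - exact: measurable_moment_integrand.
  - apply: measurable_funeM; exact: measurable_moment_integrand.
  move=> z /=; rewrite in_itv/= andbT => z0.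
  rewrite -EFinM lee_fin (powRr0 z) mul1r (powRr1 (ltW z0)) divr1.
  set t := z `^ a^-1.
  have -> : (z / 2 `^ a) `^ a^-1 = t / 2.
    rewrite powRM ?(ltW z0) ?invr_ge0 ?(ltW b0)// -/t; congr (_ * _).
    by rewrite -powRN -powRrM mulNr divff ?gt_eqF// powR_inv1.
  have zt : z = t `^ a by rewrite -powRrM mulVf ?gt_eqF// powRr1// ltW.
  have := powR_le_expR a0 (powR_ge0 z a^-1 : 0 <= t); rewrite -zt => h.
  rewrite -ler_pdivlMr ?expR_gt0//; apply: (le_trans h).
  rewrite -mulrA -expRN -expRD ler_wpM2l// ler_expR.
  by lra.
apply: lte_mul_pinfty => //; apply: lte_mul_pinfty => //.
by rewrite lee_fin mulr_ge0 ?(ltW a0) ?(ltW b0).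
Qed.

(** * Continuity, reflection and densities *)

Lemma continuous_normr_powR (R : realType) (p : R) : 0 < p ->
  continuous (fun z : R => `|z| `^ p).
Proof.
move=> p0 z; have [->|z0] := eqVneq z 0.
  apply/cvgrPdist_lt => e e0; rewrite normr0 powR0 ?gt_eqF//.
  near=> v; rewrite sub0r normrN ger0_norm ?powR_ge0//.
  have -> : e = (e `^ p^-1) `^ p.
    by rewrite -powRrM mulVf ?gt_eqF// powRr1// ltW.
  rewrite gt0_ltr_powR// ?nnegrE ?powR_ge0//.
  near: v; apply: (@pseudometric_normed_Zmodule.nbhs0_lt R R); exact: powR_gt0.
apply: (@continuous_comp _ _ _ (fun z : R => `|z|) (@powR R ^~ p)).
  exact: norm_continuous.
apply: differentiable_continuous; apply/derivable1_diffP.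
by apply: derivable_powR; rewrite in_itv/= andbT normr_gt0.
Unshelve. all: end_near. Qed.

Lemma ge0_integral_reflect (R : realType) (h : R -> R) (u : R) :
  continuous h -> (forall z, 0 <= h z) ->
  (\int[@lebesgue_measure R]_(z in `]-oo, (- u)%R[) (h z)%:E =
   \int[@lebesgue_measure R]_(z in `]u, +oo[) (h (- z)%R)%:E)%E.
Proof.
move=> ch h0.
have mh : measurable_fun setT (fun z => (h z)%:E).
  by apply/measurable_EFinP; exact: continuous_measurable_fun.
rewrite integral_itv_bndo_bndc; last exact: measurable_funTS.
rewrite ge0_integration_by_substitutionNy//; last exact: continuous_subspaceT.
rewrite -integral_itv_obnd_cbnd//; apply: measurable_funTS.
by apply: (measurableT_comp mh); exact: oppr_measurable.
Qed.

(** The density is almost everywhere the Radon-Nikodym derivative of the law of Z,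
for which the change of measure is known. *)
Lemma ge0_integral_density (R : realType) (d : measure_display)
    (T : measurableType d) (P : probability T R) (Z : {RV P >-> R})
    (f : R -> R) (D : set R) (h : R -> R) :
  has_density Z f -> measurable D -> measurable_fun setT h ->
  (forall z, D z -> 0 <= h z) ->
  (\int[P]_(w in Z @^-1` D) (h (Z w))%:E =
   \int[@lebesgue_measure R]_(z in D) (h z * f z)%:E)%E.
Proof.
move=> [mf f0 Pf] mD mh h0.
pose mu := @lebesgue_measure R.
(* The Lebesgue measure lives on another copy of the Borel sigma-algebra of R than
   the law of Z: the law is rebuilt there so that the two can be compared. *)
have mZ : @measurable_fun _ _ T (measurableTypeR R) setT Z.
  by move=> mT A mA; exact: (measurable_funPT Z mT A mA).
pose ZR : {mfun T >-> measurableTypeR R} :=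
  HB.pack (Z : T -> R) (@isMeasurableFun.Build _ _ T (measurableTypeR R) Z mZ).
pose nu := @distribution _ _ T (measurableTypeR R) R P ZR.
have nuE A : measurable A -> nu A = (\int[mu]_(z in A) (f z)%:E)%E by exact: Pf.
have mhE : measurable_fun setT (fun z => (h z)%:E) by exact/measurable_EFinP.
have mfE : measurable_fun setT (fun z => (f z)%:E) by exact/measurable_EFinP.
rewrite -(@ge0_integral_pushforward _ _ _ _ _ ZR _ P D (fun z => (h z)%:E))//;
  last 2 first.
- exact: measurable_funTS.
- by move=> z /set_mem Dz; rewrite lee_fin h0.
have numu : nu `<< mu.
  apply/null_content_dominatesP => A mA A0.
  by rewrite nuE// null_set_integral//; exact: measurable_funTS.
rewrite integral_mkcond [RHS]integral_mkcond.
have hD0 x : (0 <= ((fun z => (h z)%:E) \_ D) x)%E.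
  by apply: erestrict_ge0 => z Dz; rewrite lee_fin h0.
have mhD : measurable_fun setT ((fun z => (h z)%:E) \_ D).
  by apply/(measurable_restrictT _ mD); exact: measurable_funTS.
rewrite -[LHS](Radon_Nikodym_SigmaFinite.change_of_variables numu)//.
have intRN := Radon_Nikodym_SigmaFinite.f_integrable numu.
apply: ae_eq_integral => //.
- apply: emeasurable_funM => //; exact: measurable_int intRN.
- apply/(measurable_restrictT _ mD); apply: measurable_funTS.
  by apply/measurable_EFinP/measurable_funM.
- have : ae_eq mu setT (Radon_Nikodym_SigmaFinite.f nu mu) (fun z => (f z)%:E).
    apply: integral_ae_eq => // E _ mE.
    by rewrite -Radon_Nikodym_SigmaFinite.f_integral//; exact: nuE.
  apply: filterS => z /(_ I) e _; rewrite e /patch; case: ifP => // _.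
  by rewrite mul0e.
Qed.

(** * The density and its tail moments *)

Lemma fZN (R : realType) (a b z : R) : fZ a b (- z) = fZ a b z.
Proof. by rewrite /fZ mulNr normrN. Qed.

Lemma continuous_fZ (R : realType) (a b : R) : 0 < a -> continuous (fZ a b).
Proof.
move=> a0 z; apply: (cvgM (cvg_cst _)).
apply: (@continuous_comp _ _ _ (fun z : R => - `|z / b| `^ a^-1) expR).
  apply: continuousN.
  apply: (@continuous_comp _ _ _ (fun z : R => z / b) (fun z : R => `|z| `^ a^-1)).
    exact: (cvgM cvg_id (cvg_cst b^-1)).
  by apply: continuous_normr_powR; rewrite invr_gt0.
exact: continuous_expR.
Qed.

Lemma continuous_normX (R : realType) (j : nat) :
  continuous (fun z : R => `|z| ^+ j).
Proof.
move=> z; apply: (@continuous_comp _ _ _ (fun z : R => `|z|) (fun z : R => z ^+ j)).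
  exact: norm_continuous.
exact: exprn_continuous.
Qed.

(** The value of E[|Z|^j ; Z >= u] for u >= 0, when it is finite. *)
Definition tailMoment {R : realType} (a b : R) (j : nat) (u : R) : R :=
  b ^+ j * upperGamma (a * (j%:R + 1)) (`|u / b| `^ a^-1) / (2 * gammaFun a).

Section TailMoments.
Context (R : realType) (a b : R) (d : measure_display) (T : measurableType d)
  (P : probability T R) (Z : {RV P >-> R}).
Context (a0 : 0 < a) (b0 : 0 < b) (hZ : has_density Z (fZ a b)).

Let f0 (z : R) : 0 <= fZ a b z.
Proof. by case: hZ. Qed.

(** Were gammaFun a zero, which includes the case of a divergent integral, the
normalizing constant and hence the density would vanish identically. *)
Lemma fZ_mass : tailGamma a 0 = (gammaFun a)%:E /\ 0 < gammaFun a.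
Proof.
have h0 : 0 <= gammaFun a by rewrite gammaFunE fine_ge0// tailGamma_ge0.
have : gammaFun a != 0.
  apply/eqP => g0; have [_ _ /(_ setT measurableT)] := hZ.
  rewrite probability_setT integral0_eq//; first by move/eqP; rewrite eqe oner_eq0.
  by move=> z _; rewrite /fZ g0 mulr0 invr0 mul0r.
move=> g1; split; last by rewrite lt0r g1.
move: g1; rewrite gammaFunE; case: (tailGamma a 0) => //=; by rewrite eqxx.
Qed.

Lemma tail_density (j : nat) (u : R) : 0 <= u ->
  (tailGamma (a * (j%:R + 1)) 0 < +oo)%E ->
  (\int[@lebesgue_measure R]_(z in `]u, +oo[) (`|z| ^+ j * fZ a b z)%:E
   = (tailMoment a b j u)%:E)%E.
Proof.
move=> u0 fin; have [_ g0] := fZ_mass.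
(* K is kept abstract so that unification does not unfold gammaFun. *)
have [K KE] : exists K, K = (2 * a * b * gammaFun a)^-1 by eexists.
have K0 : 0 < K by rewrite KE invr_gt0 !mulr_gt0.
transitivity (K%:E * \int[@lebesgue_measure R]_(z in `]u, +oo[)
   (z `^ j%:R * expR (- ((z / b) `^ a^-1)))%:E)%E.
  rewrite -ge0_integralZl; last 4 first.
  - exact: measurable_itv.
  - exact: measurable_moment_integrand.
  - by move=> z _; rewrite lee_fin mulr_ge0 ?powR_ge0 ?expR_ge0.
  - by rewrite lee_fin ltW.
  apply: eq_integral => z; rewrite inE/= in_itv/= andbT => uz.
  have z0 : 0 <= z by rewrite ltW// (le_lt_trans u0).
  rewrite -EFinM.
  rewrite (powR_mulrn j z0).
  rewrite (ger0_norm z0).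
  rewrite /fZ.
  rewrite -KE.
  rewrite ger0_norm ?divr_ge0 ?(ltW b0)//.
  by rewrite mulrCA.
rewrite tail_moment// /tailMoment upperGammaE ger0_norm ?divr_ge0 ?(ltW b0)//.
set y := tailGamma _ _.
have yfin : y \is a fin_num by apply: tailGamma_fin_num => //; exact: powR_ge0.
rewrite -(fineK yfin) -!EFinM; congr EFin.
rewrite natr1 (powR_mulrn j.+1 (ltW b0)) exprS KE.
by field; rewrite !gt_eqF.
Qed.

Lemma moment_up (j : nat) (u : R) : 0 <= u ->
  (tailGamma (a * (j%:R + 1)) 0 < +oo)%E ->
  (\int[P]_(w in Z @^-1` `[u, +oo[) (`|Z w| ^+ j)%:E = (tailMoment a b j u)%:E)%E.
Proof.
move=> u0 fin.
rewrite (@ge0_integral_density _ _ _ _ _ _ _ (fun z => `|z| ^+ j) hZ)//; last first.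
  apply: continuous_measurable_fun; exact: continuous_normX.
rewrite -integral_itv_obnd_cbnd ?tail_density//.
apply/measurable_funTS/measurable_EFinP/measurable_funM; last by case: hZ.
apply: continuous_measurable_fun; exact: continuous_normX.
Qed.

Lemma moment_down (j : nat) (u : R) : 0 <= u ->
  (tailGamma (a * (j%:R + 1)) 0 < +oo)%E ->
  (\int[P]_(w in Z @^-1` `]-oo, (- u)%R[) (`|Z w| ^+ j)%:E
   = (tailMoment a b j u)%:E)%E.
Proof.
move=> u0 fin.
rewrite (@ge0_integral_density _ _ _ _ _ _ _ (fun z => `|z| ^+ j) hZ)//; last first.
  apply: continuous_measurable_fun; exact: continuous_normX.
rewrite (@ge0_integral_reflect _ (fun z => `|z| ^+ j * fZ a b z)).
- under eq_integral do rewrite normrN fZN; exact: tail_density.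
- move=> z; apply: cvgM; [exact: continuous_normX|exact: continuous_fZ].
- by move=> z; rewrite mulr_ge0 ?exprn_ge0.
Qed.

Lemma tailGamma_double_fin : (tailGamma (a * (1 + 1)) 0 < +oo)%E.
Proof.
by apply: tailGamma_double_lty => //; case: fZ_mass => -> _; rewrite ltry.
Qed.

Lemma integrable_fZ : P.-integrable setT (EFin \o Z).
Proof.
have fin1 := tailGamma_double_fin.
apply/integrableP; split; first exact/measurable_EFinP.
rewrite (eq_integral (fun w => (`|Z w| ^+ 1)%:E))//.
have -> : [set: T] = Z @^-1` `[0, +oo[ `|` Z @^-1` `]-oo, (- 0)%R[.
  apply/seteqP; split => // w _ /=; rewrite !in_itv/= andbT oppr0.
  by case: (leP 0 (Z w)); [left|right].
rewrite ge0_integral_setU//=.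
- rewrite moment_up ?moment_down//; first by rewrite -EFinD ltry.
- by rewrite -[_ @^-1` _]setTI; exact: measurable_funPT.
- by rewrite -[_ @^-1` _]setTI; exact: measurable_funPT.
- by apply: measurable_funTS; apply/measurable_EFinP; exact: measurableT_comp.
- apply/disj_setPS => w [/=]; rewrite !in_itv/= andbT oppr0 => h1 h2.
  by move: (le_lt_trans h1 h2); rewrite ltxx.
Qed.

End TailMoments.

(** * Convexity of the expected loss *)

Definition slope {R : realType} (k1 k2 z : R) : R := if 0 <= z then k1 else - k2.

Lemma loss_slope (R : realType) (k1 k2 z : R) :
  loss k1 k2 z = slope k1 k2 z * z.
Proof. by rewrite /loss /slope; case: ifP. Qed.

Lemma loss_subgradient (R : realType) (k1 k2 y z : R) : 0 <= k1 -> 0 <= k2 ->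
  loss k1 k2 y + slope k1 k2 y * (z - y) <= loss k1 k2 z.
Proof.
move=> k10 k20; rewrite loss_slope -mulrDr addrC subrK loss_slope /slope.
by case: (leP 0 y) => hy; case: (leP 0 z) => hz; nra.
Qed.

(** The subgradient inequality at x and at x + h encloses f (x + h) - f x between
p x * h and p (x + h) * h, so the difference quotient is within M |h| of p x. *)
Lemma is_derive_subgradient (R : realType) (f p : R -> R) (M x : R) :
  (forall y z, f y + p y * (z - y) <= f z) ->
  (forall y z, `|p z - p y| <= M * `|z - y|) ->
  is_derive x 1 f (p x).
Proof.
move=> sub lip.
have M0 : 0 <= M.
  by have := lip 0 1; rewrite subr0 normr1 mulr1; apply: le_trans.
have lim : (fun h : R => h^-1 *: (f (h *: (1 : R) + x) - f x)) @ 0^' --> p x.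
  apply/cvgrPdist_le => e e0; near=> h.
  have h0 : h != 0 by near: h; exact: nbhs_dnbhs_neq.
  have hM : `|h| < e / (M + 1).
    near: h; apply: dnbhs0_lt.
    by rewrite divr_gt0// ltr_wpDl.
  have -> : h *: (1 : R) + x = x + h by rewrite addrC; congr (_ + _); exact: mulr1.
  have s1 := sub x (x + h); have s2 := sub (x + h) x; have l := lip x (x + h).
  rewrite addrAC subrr add0r in s1 l.
  have E : x - (x + h) = - h by ring.
  rewrite E in s2.
  rewrite -(ler_pM2l (_ : 0 < `|h|)) ?normr_gt0// -normrM.
  have -> : h * (p x - h^-1 *: (f (x + h) - f x)) = p x * h - (f (x + h) - f x).
    rewrite mulrBr mulrC; congr (_ - _).
    by rewrite -[_ *: _]/(_ * _) mulrA divff// mul1r.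
  have A1 : `|p x * h - (f (x + h) - f x)| <= `|(p (x + h) - p x) * h|.
    rewrite -normrN ger0_norm; last by lra.
    by apply: le_trans (ler_norm _); lra.
  apply: (le_trans A1); rewrite normrM mulrC ler_wpM2l//.
  apply: (le_trans l); apply: (@le_trans _ _ ((M + 1) * `|h|)).
    by rewrite ler_wpM2r// lerDl.
  rewrite mulrC -ler_pdivlMr; [exact: ltW | by rewrite ltr_wpDl].
split; first by apply/cvg_ex; exists (p x).
exact: cvg_lim lim.
Unshelve. all: end_near. Qed.

(** The strict inequality matches the convention that the loss has slope k1
at 0. *)
Definition strict_cdf {R : realType} {d : measure_display}
    {T : measurableType d} {P : probability T R} (Z : {RV P >-> R}) (u : R) : R :=
  fine (P (Z @^-1` `]-oo, u[)).

Definition expSlope {R : realType} {d : measure_display}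
    {T : measurableType d} {P : probability T R} (Z : {RV P >-> R})
    (k1 k2 c : R) : R :=
  k1 - (k1 + k2) * strict_cdf Z (- c).

Section ExpectedLoss.
Context (R : realType) (d : measure_display) (T : measurableType d)
  (P : probability T R) (Z : {RV P >-> R}) (k1 k2 : R)
  (k10 : 0 < k1) (k20 : 0 < k2) (intZ : P.-integrable setT (EFin \o Z)).


Lemma measurable_slope : measurable_fun setT (slope k1 k2).
Proof.
rewrite /slope; apply: measurable_fun_ifT => //.
exact: measurable_fun_ler.
Qed.

Lemma integrable_bounded (h : R -> R) c : measurable_fun setT h ->
  (exists M, forall z, `|h z| <= M) ->
  P.-integrable setT (EFin \o (fun w => h (Z w + c) )).
Proof.
move=> mh [M hM]; apply: measurable_bounded_integrable => //.
- by rewrite (@le_lt_trans _ _ 1%E) ?probability_le1 ?ltry.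
- by apply: (measurableT_comp mh); exact: measurable_funD.
- exists M; split; rewrite ?num_real// => x Mx w _.
  by apply: le_trans (hM _) (ltW Mx).
Qed.

Lemma integrable_shift c : P.-integrable setT (EFin \o (fun w => Z w + c)).
Proof.
have -> : EFin \o (fun w => Z w + c) = (EFin \o Z) \+ (EFin \o cst c) by [].
by apply: integrableD => //; exact: finite_measure_integrable_cst.
Qed.

Lemma integrable_slope c :
  P.-integrable setT (EFin \o (fun w => slope k1 k2 (Z w + c))).
Proof.
apply: integrable_bounded; first exact: measurable_slope.
exists (k1 + k2) => z; rewrite /slope; case: ifP => _.
  by rewrite gtr0_norm// lerDl ltW.
by rewrite normrN gtr0_norm// lerDr ltW.
Qed.

Lemma integrable_slopeMr c r :
  P.-integrable setT (EFin \o (fun w => slope k1 k2 (Z w + c) * r)).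
Proof.
rewrite (_ : _ \o _ = fun w => ((slope k1 k2 (Z w + c))%:E * r%:E)%E)//.
by apply: integrableZr => //; exact: integrable_slope.
Qed.

Lemma integrable_loss c :
  P.-integrable setT (EFin \o (fun w => loss k1 k2 (Z w + c))).
Proof.
have mZc : measurable_fun setT (fun w => Z w + c) by exact: measurable_funD.
apply: (@le_integrable _ _ _ P _ measurableT _
  (fun w => (k1 + k2)%:E * (Z w + c)%:E)%E).
- apply/measurable_EFinP.
  under eq_fun do rewrite loss_slope.
  by apply: measurable_funM => //; exact: (measurableT_comp measurable_slope).
- move=> w _ /=; rewrite lee_fin loss_slope !normrM ler_wpM2r//.
  rewrite [leRHS]gtr0_norm ?addr_gt0// /slope; case: ifP => _.
    by rewrite gtr0_norm// lerDl ltW.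
  by rewrite normrN gtr0_norm// lerDr ltW.
- by apply: integrableZl => //; exact: integrable_shift.
Qed.

Lemma expLossE c :
  expLoss Z k1 k2 c = (\int[P]_w loss k1 k2 (Z w + c))%:E.
Proof.
rewrite /expLoss unlock fineK//; apply: integrable_fin_num => //.
exact: integrable_loss.
Qed.

Lemma measurable_preZ (D : set R) : measurable D -> measurable (Z @^-1` D).
Proof. by move=> mD; rewrite -[_ @^-1` _]setTI; exact: measurable_funPT. Qed.

Lemma preimage_itv_split u : setT = Z @^-1` `]-oo, u[ `|` Z @^-1` `[u, +oo[.
Proof.
apply/seteqP; split => // w _ /=; rewrite !in_itv/= andbT.
by case: (leP u (Z w)); [right|left].
Qed.

Lemma preimage_itv_disj u :
  [disjoint (Z @^-1` `]-oo, u[) & (Z @^-1` `[u, +oo[)].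
Proof.
apply/disj_setPS => w [/=]; rewrite !in_itv/= andbT => h1 h2.
by move: (le_lt_trans h2 h1); rewrite ltxx.
Qed.

Lemma Rintegral_split (h : T -> R) u : P.-integrable setT (EFin \o h) ->
  \int[P]_w h w = \int[P]_(w in Z @^-1` `]-oo, u[) h w
                + \int[P]_(w in Z @^-1` `[u, +oo[) h w.
Proof.
move=> ih; rewrite (preimage_itv_split u) Rintegral_setU//.
- exact: measurable_preZ.
- exact: measurable_preZ.
- by rewrite -preimage_itv_split.
- exact: preimage_itv_disj.
Qed.

Lemma strict_cdf_compl u : strict_cdf Z u = 1 - fine (P (Z @^-1` `[u, +oo[)).
Proof.
have := probability_setT P; rewrite {1}(preimage_itv_split u).
rewrite measureU; [|exact: measurable_preZ|exact: measurable_preZ|]; last first.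
  by apply/eqP; exact: preimage_itv_disj.
rewrite -[X in (X + _)%E]fineK ?fin_num_measure//; last exact: measurable_preZ.
rewrite -[X in (_ + X)%E]fineK ?fin_num_measure//; last exact: measurable_preZ.
by rewrite -EFinD => -[<-]; rewrite addrK.
Qed.

Lemma slope_split c :
  (forall w, (Z @^-1` `]-oo, (- c)%R[) w -> slope k1 k2 (Z w + c) = - k2) /\
  (forall w, (Z @^-1` `[(- c)%R, +oo[) w -> slope k1 k2 (Z w + c) = k1).
Proof.
split => w /=; rewrite in_itv/= /slope -subr_ge0.
  by rewrite subr_ge0 => h; rewrite leNgt -ltrBrDr sub0r h.
by rewrite opprK andbT => ->.
Qed.

Lemma Rintegral_slope c : \int[P]_w slope k1 k2 (Z w + c) = expSlope Z k1 k2 c.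
Proof.
rewrite (Rintegral_split (- c)); last exact: integrable_slope.
have [sA sB] := slope_split c.
rewrite (@eq_Rintegral _ _ _ _ _ (cst (- k2))); last by move=> w /set_mem /sA.
rewrite [X in _ + X](@eq_Rintegral _ _ _ _ _ (cst k1));
  last by move=> w /set_mem /sB.
rewrite !Rintegral_cst; [|exact: measurable_preZ|exact: measurable_preZ].
by rewrite -/(strict_cdf Z (- c)) /expSlope strict_cdf_compl; ring.
Qed.

(** The subgradient inequality of the loss, integrated. *)
Lemma expLoss_subgradient c c' :
  fine (expLoss Z k1 k2 c) + expSlope Z k1 k2 c * (c' - c)
    <= fine (expLoss Z k1 k2 c').
Proof.
rewrite !expLossE /= -Rintegral_slope -RintegralZr//; last exact: integrable_slope.
have iS := integrable_slopeMr c (c' - c).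
rewrite -RintegralD//; last exact: integrable_loss.
apply: le_Rintegral => //.
- rewrite (_ : _ \o _ = (EFin \o (fun w => loss k1 k2 (Z w + c))) \+
     (EFin \o (fun w => slope k1 k2 (Z w + c) * (c' - c))))//.
  by apply: integrableD => //; exact: integrable_loss.
- exact: integrable_loss.
move=> w _; have := loss_subgradient (Z w + c) (Z w + c') (ltW k10) (ltW k20).
by have -> : Z w + c' - (Z w + c) = c' - c by ring.
Qed.

(** On each side of - c the loss is linear, with value slope * (Z + c): the part
slope * c integrates to the first term, the part slope * Z to the others. *)
Lemma expLoss_value c :
  fine (expLoss Z k1 k2 c) = c * expSlope Z k1 k2 c
    + (k1 * \int[P]_(w in Z @^-1` `[(- c), +oo[) Z w
       - k2 * \int[P]_(w in Z @^-1` `]-oo, (- c)%R[) Z w).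
Proof.
have [sA sB] := slope_split c.
have iZ D : measurable D -> P.-integrable D (EFin \o Z).
  by move=> mD; apply: integrableS intZ.
have iSZ : P.-integrable setT (EFin \o (fun w => slope k1 k2 (Z w + c) * Z w)).
  rewrite (_ : _ \o _ = ((EFin \o (fun w => loss k1 k2 (Z w + c)%R)) \-
     (EFin \o (fun w => (slope k1 k2 (Z w + c) * c)%R)))%E); last first.
    by apply/funext => w /=; rewrite loss_slope; congr EFin; rewrite mulrDr addrK.
  by apply: integrableB => //; [exact: integrable_loss|exact: integrable_slopeMr].
rewrite expLossE /=.
rewrite (@eq_Rintegral _ _ _ _ _
  (fun w => slope k1 k2 (Z w + c) * Z w + slope k1 k2 (Z w + c) * c)); last first.
  by move=> w _; rewrite loss_slope mulrDr.
rewrite RintegralD//; last exact: integrable_slopeMr.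
rewrite RintegralZr//; last exact: integrable_slope.
rewrite Rintegral_slope addrC mulrC; congr (_ + _).
rewrite (Rintegral_split (- c))// addrC; congr (_ + _).
  rewrite -RintegralZl//;
    [|exact: measurable_preZ|apply: iZ; exact: measurable_preZ].
  by apply: eq_Rintegral => w /set_mem /sB ->.
rewrite -mulNr -RintegralZl//;
  [|exact: measurable_preZ|apply: iZ; exact: measurable_preZ].
by apply: eq_Rintegral => w /set_mem /sA ->.
Qed.

Lemma strict_cdf_left (e : R) : 0 < e -> exists u, strict_cdf Z u < e.
Proof.
move=> e0.
have /fine_cvg cF : cdf Z @ -oo --> 0%:E by exact: cvg_cdfNy0.
have hn : \forall u \near -oo, fine (cdf Z u) < e.
  exact: (pseudometric_normed_Zmodule.cvgr_lt _ cF).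
have [u hu] := filter_ex hn; exists u.
apply: le_lt_trans hu; rewrite -lee_fin !fineK ?fin_num_measure//;
  last exact: measurable_preZ.
apply: le_measure; rewrite ?inE; try exact: measurable_preZ.
by move=> w /=; rewrite !in_itv/=; exact: ltW.
Qed.

Lemma strict_cdf_right (e : R) : e < 1 -> exists u, e < strict_cdf Z u.
Proof.
move=> e1.
have /fine_cvg cF : cdf Z @ +oo --> 1%:E by exact: cvg_cdfy1.
have hn : \forall u \near +oo, e < fine (cdf Z u).
  exact: (pseudometric_normed_Zmodule.cvgr_gt _ cF).
have [u hu] := filter_ex hn; exists (u + 1).
apply: (lt_le_trans hu); rewrite -lee_fin !fineK ?fin_num_measure//;
  last exact: measurable_preZ.
apply: le_measure; rewrite ?inE; [exact: measurable_itv..|].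
by move=> w /=; rewrite !in_itv/= => h; rewrite (le_lt_trans h)// ltrDl.
Qed.

End ExpectedLoss.

(** * The distribution function of Z *)

Section StrictCdf.
Context (R : realType) (a b : R) (d : measure_display) (T : measurableType d)
  (P : probability T R) (Z : {RV P >-> R})
  (a0 : 0 < a) (b0 : 0 < b) (hZ : has_density Z (fZ a b)).

Let K := (2 * a * b * gammaFun a)^-1.

Let K0 : 0 < K.
Proof. by rewrite invr_gt0 !mulr_gt0//; case: (fZ_mass hZ). Qed.

Lemma strict_cdf_increment (u v : R) : u <= v ->
  ((strict_cdf Z v - strict_cdf Z u)%:E
   = \int[@lebesgue_measure R]_(z in `[u, v[) (fZ a b z)%:E)%E.
Proof.
move=> uv; have [_ _ PZ] := hZ.
have mpre D : measurable D -> measurable (Z @^-1` D) by exact: measurable_preZ.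
have -> : strict_cdf Z v = strict_cdf Z u + fine (P (Z @^-1` `[u, v[)).
  rewrite /strict_cdf (@itv_bndbnd_setU _ _ _ (BLeft u))// ?bnd_simp//.
  rewrite preimage_setU.
  rewrite measureU; [|exact: mpre|exact: mpre|].
    by rewrite fineD// fin_num_measure//; exact: mpre.
  apply/seteqP; split => // w [/=]; rewrite !in_itv/= => h1 /andP[h2 _].
  by move: (le_lt_trans h2 h1); rewrite ltxx.
rewrite addrC addKr fineK ?fin_num_measure//; last exact: mpre.
exact: PZ.
Qed.

(** K is the maximum of the density, attained at 0. *)
Lemma strict_cdf_lipschitz (u v : R) :
  `|strict_cdf Z v - strict_cdf Z u| <= K * `|v - u|.
Proof.
wlog uv : u v / u <= v.
  move=> h; case: (leP u v) => [|/ltW] /h//.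
  by rewrite distrC [in leRHS]distrC.
have mf : measurable_fun setT (fun z => (fZ a b z)%:E).
  by apply/measurable_EFinP; case: hZ.
have F0 : (0 <= (strict_cdf Z v - strict_cdf Z u)%:E)%E.
  rewrite strict_cdf_increment//; apply: integral_ge0 => z _.
  by rewrite lee_fin; case: hZ.
rewrite ger0_norm -?lee_fin// strict_cdf_increment//.
apply: (@le_trans _ _ (\int[@lebesgue_measure R]_(z in `[u, v[) (cst K%:E z))%E).
  apply: ge0_le_integral => //.
  - by move=> z _; rewrite lee_fin; case: hZ.
  - exact: measurable_funTS.
  - move=> z _; rewrite lee_fin /fZ -/K; apply: ler_piMr; first exact: ltW.
    by rewrite -expR0 ler_expR oppr_le0 powR_ge0.
rewrite integral_cst//= lebesgue_measure_itv/= lte_fin.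
case: ifPn => uv'; last by rewrite mule0 lee_fin mulr_ge0 ?(ltW K0).
by rewrite -EFinD -EFinM lee_fin ger0_norm ?subr_ge0.
Qed.

(** The density decreases in |z|, so on [u, v[ it is at least its value at
max(|u|, |v|), which is positive. *)
Lemma strict_cdf_increasing (u v : R) :
  u < v -> strict_cdf Z u < strict_cdf Z v.
Proof.
move=> uv; rewrite -subr_gt0 -lte_fin strict_cdf_increment ?ltW//.
pose M := Num.max `|u| `|v|.
have [k k0 kM] : exists2 k, 0 < k & k = fZ a b M.
  by exists (fZ a b M) => //; rewrite mulr_gt0// expR_gt0.
have mf : measurable_fun setT (fun z => (fZ a b z)%:E).
  by apply/measurable_EFinP; case: hZ.
apply: (@lt_le_trans _ _ (\int[@lebesgue_measure R]_(z in `[u, v[) (cst k%:E z))%E).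
  rewrite integral_cst//= lebesgue_measure_itv/= lte_fin uv -EFinD -EFinM lte_fin.
  by rewrite mulr_gt0// subr_gt0.
apply: ge0_le_integral => //.
- by move=> z _; rewrite lee_fin ltW.
- exact: measurable_funTS.
move=> z /=; rewrite in_itv/= => /andP[uz zv].
rewrite lee_fin kM /fZ -/K (ler_pM2l K0) ler_expR lerN2.
apply: ge0_ler_powR; rewrite ?nnegrE// ?invr_ge0 ?(ltW a0)//.
rewrite !normrM ler_wpM2r// [leRHS]ger0_norm; last by rewrite /M le_max normr_ge0.
rewrite /M le_max; case: (leP 0 z) => z0.
  by rewrite (ger0_norm z0) (le_trans (ltW zv) (ler_norm v)) orbT.
rewrite (ltr0_norm z0); apply/orP; left.
by rewrite -(normrN u) (le_trans _ (ler_norm _))// lerN2.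
Qed.

Lemma strict_cdf_surj q : 0 < q < 1 -> exists u, strict_cdf Z u = q.
Proof.
move=> /andP[q0 q1].
have [u uq] := strict_cdf_left Z q0.
have [v qv] := strict_cdf_right Z q1.
have uv : u <= v.
  case: (leP u v) => // /strict_cdf_increasing vu.
  by have := lt_trans (lt_trans uq qv) vu; rewrite ltxx.
have cF : continuous (strict_cdf Z : R -> R).
  move=> x; apply/cvgrPdist_le => e e0; near=> y.
  apply: (le_trans (strict_cdf_lipschitz _ _)).
  rewrite mulrC -ler_pdivlMr//; near: y.
  apply: cvgr_dist_le; [exact: cvg_id|exact: divr_gt0].
have [|c _ Fc] := @IVT R (strict_cdf Z) u v q uv (continuous_subspaceT cF).
  by rewrite ge_min le_max (ltW uq) (ltW qv) orbT.
by exists c.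
Unshelve. all: end_near. Qed.

End StrictCdf.

(** * The stationary point *)

Section Main.
Context (R : realType) (a b k1 k2 : R) (d : measure_display)
  (T : measurableType d) (P : probability T R) (Z : {RV P >-> R})
  (a0 : 0 < a) (b0 : 0 < b) (k10 : 0 < k1) (k20 : 0 < k2)
  (hZ : has_density Z (fZ a b)).

Let intZ : P.-integrable setT (EFin \o Z).
Proof. exact: integrable_fZ hZ. Qed.

Let fin0 : (tailGamma (a * (0 + 1)) 0 < +oo)%E.
Proof.
have [e _] := fZ_mass hZ.
by rewrite add0r mulr1 e ltry.
Qed.

Let fin1 : (tailGamma (a * (1 + 1)) 0 < +oo)%E.
Proof. exact: tailGamma_double_fin a0 hZ. Qed.

Lemma expLoss_is_derive (c : R) :
  is_derive c 1 (fun c : R => fine (expLoss Z k1 k2 c)) (expSlope Z k1 k2 c).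
Proof.
apply: (@is_derive_subgradient R _ (expSlope Z k1 k2)
  ((k1 + k2) * (2 * a * b * gammaFun a)^-1)).
  by move=> y z; exact: expLoss_subgradient.
move=> y z; rewrite /expSlope.
have -> : k1 - (k1 + k2) * strict_cdf Z (- z)
      - (k1 - (k1 + k2) * strict_cdf Z (- y))
    = (k1 + k2) * (strict_cdf Z (- y) - strict_cdf Z (- z)) by ring.
rewrite normrM gtr0_norm ?addr_gt0// -mulrA ler_pM2l ?addr_gt0//.
have -> : z - y = - y - - z by ring.
exact: strict_cdf_lipschitz.
Qed.

Lemma expLoss_stationary (c : R) :
  is_derive c 1 (fun c : R => fine (expLoss Z k1 k2 c)) 0 <->
  expSlope Z k1 k2 c = 0.
Proof.
have D := expLoss_is_derive c; split=> [D0|<-//].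
by have [_ <-] := D; have [_ ->] := D0.
Qed.

Lemma expSlope_increasing (c c' : R) :
  c < c' -> expSlope Z k1 k2 c < expSlope Z k1 k2 c'.
Proof.
move=> cc'; rewrite /expSlope ltrD2l ltrN2 ltr_pM2l ?addr_gt0//.
by apply: (strict_cdf_increasing a0 b0 hZ); rewrite ltrN2.
Qed.

(** p(c) = 0 means F(- c) = k1 / (k1 + k2), a value strictly between 0 and 1,
which the continuous function F attains. *)
Lemma expSlope_root : exists c, expSlope Z k1 k2 c = 0.
Proof.
have k0 : 0 < k1 + k2 by rewrite addr_gt0.
have q01 : 0 < k1 / (k1 + k2) < 1.
  by rewrite divr_gt0//= ltr_pdivrMr// mul1r ltrDl.
have [u uq] := strict_cdf_surj a0 b0 hZ q01.
exists (- u); rewrite /expSlope opprK uq mulrCA divff ?gt_eqF//.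
by rewrite mulr1 subrr.
Qed.

Lemma prob_moment0 (D : set R) : measurable D ->
  P (Z @^-1` D) = (\int[P]_(w in Z @^-1` D) (`|Z w| ^+ 0)%:E)%E.
Proof.
move=> mD; under eq_integral do rewrite expr0.
by rewrite integral_cst ?mul1e//; exact: measurable_preZ.
Qed.

Lemma strict_cdf_nonpos (u : R) : 0 <= u -> strict_cdf Z (- u) = tailMoment a b 0 u.
Proof.
move=> u0; rewrite /strict_cdf prob_moment0//.
by rewrite (moment_down a0 b0 hZ).
Qed.

Lemma strict_cdf_nonneg (u : R) : 0 <= u -> strict_cdf Z u = 1 - tailMoment a b 0 u.
Proof.
move=> u0; rewrite strict_cdf_compl prob_moment0//.
by rewrite (moment_up a0 b0 hZ).
Qed.

Lemma Rintegral_up (u : R) : 0 <= u ->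
  \int[P]_(w in Z @^-1` `[u, +oo[) Z w = tailMoment a b 1 u.
Proof.
move=> u0; rewrite /Rintegral -[RHS]/(fine (tailMoment a b 1 u)%:E).
rewrite -(moment_up (j := 1) a0 b0 hZ u0 fin1); congr fine.
apply: eq_integral => w /set_mem /=; rewrite in_itv/= andbT => uZ.
by rewrite expr1 ger0_norm// (le_trans u0).
Qed.

Lemma Rintegral_down (u : R) : 0 <= u ->
  \int[P]_(w in Z @^-1` `]-oo, (- u)%R[) Z w = - tailMoment a b 1 u.
Proof.
move=> u0; have mD := measurable_preZ Z (measurable_itv `]-oo, (- u)[).
rewrite (@eq_Rintegral _ _ _ _ _ (fun w => -1 * `|Z w|)); last first.
  move=> w /set_mem /=; rewrite in_itv/= => Zu.
  by rewrite ler0_norm ?mulrNN ?mul1r// ltW// (lt_le_trans Zu)// oppr_le0.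
rewrite RintegralZl//; last first.
  by apply: (integrableS measurableT) => //; exact: integrable_norm.
rewrite mulN1r; congr (- _).
rewrite /Rintegral -[RHS]/(fine (tailMoment a b 1 u)%:E).
by rewrite -(moment_down (j := 1) a0 b0 hZ u0 fin1).
Qed.

Lemma Rintegral_centered : \int[P]_w Z w = 0.
Proof.
have := Rintegral_split Z (- 0) intZ.
rewrite Rintegral_down//; have := Rintegral_up (lexx 0).
by rewrite -{1}oppr0 => ->; rewrite addNr.
Qed.

(** One of the two integrals is a tail not meeting the origin, computed directly;
the other is its opposite because Z is centered. *)
Lemma tail_integrals (c : R) :
  \int[P]_(w in Z @^-1` `[(- c)%R, +oo[) Z w = tailMoment a b 1 `|c| /\
  \int[P]_(w in Z @^-1` `]-oo, (- c)%R[) Z w = - tailMoment a b 1 `|c|.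
Proof.
have := Rintegral_split Z (- c) intZ.
rewrite Rintegral_centered.
case: (leP 0 c) => c0.
  rewrite (Rintegral_down c0) (ger0_norm c0) => e; split=> [|//].
  by rewrite -[LHS](addKr (- tailMoment a b 1 c)) -e addr0 opprK.
have Nc0 : 0 <= - c by rewrite oppr_ge0 ltW.
rewrite (Rintegral_up Nc0) (ltr0_norm c0) => e; split=> [//|].
by rewrite -[LHS](addrK (tailMoment a b 1 (- c))) -e sub0r.
Qed.

(** A single expression for both signs of c: F(- c) is the tail beyond |c| when
c >= 0, and its complement when c < 0. *)
Lemma expSlope_sgn (c : R) :
  expSlope Z k1 k2 c
    = (k1 - k2) / 2 + Sgn c * ((k1 + k2) * (2^-1 - tailMoment a b 0 `|c|)).
Proof.
rewrite /expSlope /Sgn; case: (leP 0 c) => c0.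
  by rewrite (strict_cdf_nonpos c0) (ger0_norm c0); field.
have Nc0 : 0 <= - c by rewrite oppr_ge0 ltW.
by rewrite (strict_cdf_nonneg Nc0) (ltr0_norm c0); field.
Qed.

Lemma tailMoment0E (c : R) : tailMoment a b 0 `|c| =
  upperGamma a (`|c / b| `^ a^-1) / (2 * gammaFun a).
Proof.
rewrite /tailMoment expr0 mul1r add0r mulr1.
by rewrite [`| _ / _|]normrM normr_id -normrM.
Qed.

Lemma tailMoment1E (c : R) : tailMoment a b 1 `|c| =
  b * upperGamma (2 * a) (`|c / b| `^ a^-1) / (2 * gammaFun a).
Proof.
rewrite /tailMoment expr1 [`| _ / _|]normrM normr_id -normrM.
by have -> : a * (1%:R + 1) = 2 * a by ring.
Qed.

(** The slope is strictly increasing and equals (k1 - k2) / 2 at 0, so the position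
of its zero relative to 0 is decided by the sign of k2 - k1. *)
Lemma Sgn_root (c : R) : expSlope Z k1 k2 c = 0 ->
  Sgn c = Sgn (k2 - k1) /\ (c = 0 -> k1 = k2).
Proof.
move=> c0.
have [massE g0] := fZ_mass hZ.
have S0 : expSlope Z k1 k2 0 = (k1 - k2) / 2.
  rewrite expSlope_sgn tailMoment0E mul0r normr0 powR0 ?gt_eqF ?invr_gt0//.
  have -> : upperGamma a 0 = gammaFun a by [].
  have -> : gammaFun a / (2 * gammaFun a) = 2^-1 by field; rewrite gt_eqF.
  by rewrite subrr !mulr0 addr0.
split; last by move=> cE; move: c0; rewrite cE S0 => ?; lra.
rewrite /Sgn; case: (leP 0 c) => hc; case: (leP 0 (k2 - k1)) => hk//.
- move: hc; rewrite le_eqVlt => /predU1P[cE|/expSlope_increasing].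
    by move: c0; rewrite -cE S0 => ?; lra.
  by rewrite c0 S0 => ?; lra.
- by move/expSlope_increasing : hc; rewrite c0 S0 => ?; lra.
Qed.

Lemma lowerGamma_root (c : R) : expSlope Z k1 k2 c = 0 ->
  lowerGamma a (`|c / b| `^ a^-1)
    = Sgn c * ((k2 - k1) / (k1 + k2)) * gammaFun a.
Proof.
rewrite expSlope_sgn tailMoment0E.
have [massE g0] := fZ_mass hZ.
rewrite lowerGammaE ?powR_ge0//; last by rewrite massE ltry.
set y := upperGamma _ _; set g := gammaFun a in g0 *.
have k0 : 0 < k1 + k2 by rewrite addr_gt0.
have g1 : g != 0 by rewrite gt_eqF.
have k0' : k1 + k2 != 0 by rewrite gt_eqF.
have ss : Sgn c * Sgn c = 1 by rewrite /Sgn; case: ifP => _; rewrite ?mulrNN mulr1.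
(* Multiplying the stationarity equation by this factor isolates g - y, using
   that the square of the sign is 1. *)
move=> /(congr1 (fun r => r * (Sgn c * (2 * g) / (k1 + k2)))).
rewrite mul0r.
have -> : ((k1 - k2) / 2 + Sgn c * ((k1 + k2) * (2^-1 - y / (2 * g))))
      * (Sgn c * (2 * g) / (k1 + k2))
   = (Sgn c * Sgn c) * (g - y) - Sgn c * ((k2 - k1) / (k1 + k2)) * g.
  by field; rewrite k0' g1.
by rewrite ss mul1r => /eqP; rewrite subr_eq0 => /eqP.
Qed.

End Main.

Unset Implicit Arguments.

Theorem mainTheorem2 (R : realType) (a b k1 k2 : R)
    (ha : 0 < a) (hb : 0 < b) (hk1 : 0 < k1) (hk2 : 0 < k2)
    (d : measure_display) (T : measurableType d) (P : probability T R)
    (Z : {RV P >-> R}) (hZ : has_density Z (fZ a b)) :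
  (forall c : R, expLoss Z k1 k2 c \is a fin_num) /\
  (exists! C : R, is_derive C 1 (fun c : R => fine (expLoss Z k1 k2 c)) 0) /\
  (forall C : R, is_derive C 1 (fun c : R => fine (expLoss Z k1 k2 c)) 0 ->
    [/\ (forall c : R, (expLoss Z k1 k2 C <= expLoss Z k1 k2 c)%E),
        lowerGamma a (`|C / b| `^ (a^-1))
          = Sgn C * ((k2 - k1) / (k1 + k2)) * gammaFun a,
        Sgn C = Sgn (k2 - k1),
        (C = 0 -> k1 = k2)
      & expLoss Z k1 k2 C
          = ((k1 + k2) * b / (2 * gammaFun a)
              * upperGamma (2 * a) (`|C / b| `^ (a^-1)))%:E]).
Proof.
have intZ := integrable_fZ ha hb hZ.
have finE c : expLoss Z k1 k2 c \is a fin_num.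
  by rewrite (expLossE hk1 hk2 intZ).
have stat c := expLoss_stationary ha hb hk1 hk2 hZ c.
have [C0 C0E] := expSlope_root ha hb hk1 hk2 hZ.
split=> //; split.
  exists C0; split=> [|C /stat CE]; first exact/stat.
  have inc := expSlope_increasing ha hb hk1 hk2 hZ.
  by case: (ltgtP C0 C) => // /inc; rewrite C0E CE ltxx.
move=> C /stat CE.
have [S1 S2] := Sgn_root ha hb hk1 hk2 hZ CE.
split=> //.
- move=> c; rewrite -(fineK (finE C)) -(fineK (finE c)) lee_fin.
  have := expLoss_subgradient hk1 hk2 intZ C c.
  by rewrite CE mul0r addr0.
- exact: (lowerGamma_root ha hb hk1 hk2 hZ).
rewrite -(fineK (finE C)); congr EFin.
rewrite (expLoss_value hk1 hk2 intZ) CE mulr0 add0r.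
have [-> ->] := tail_integrals ha hb hZ C.
by rewrite tailMoment1E; ring.
Qed.
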